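(* Let $\mathcal{C}$ be a small preadditive category, $\mathcal{I}$ an ideal in $\mathcal{C}$ and $k\geq1$ an integer. The following conditions are equivalent. (a) $\mathcal{I}$ is $k$-idempotent. (b) The morphism $\varphi^{i}_{F,\pi_{\ast}(F')}:\mathrm{Ext}^{i}_{\mathrm{Mod}(\mathcal{C}/\mathcal{I})}(F,F')\to\mathrm{Ext}^{i}_{\mathrm{Mod}(\mathcal{C})}(\pi_{\ast}(F),\pi_{\ast}(F'))$ is an isomorphism for all $F,F'\in\mathrm{Mod}(\mathcal{C}/\mathcal{I})$ and all $0\leq i\leq k$. (c) $\mathbb{EXT}^{i}_{\mathcal{C}}(\mathcal{C}/\mathcal{I},F'\circ\pi)=0$ for $1\leq i\leq k$ and for all $F'\in\mathrm{Mod}(\mathcal{C}/\mathcal{I})$. (d) $\mathbb{EXT}^{i}_{\mathcal{C}}(\mathcal{C}/\mathcal{I},J\circ\pi)=0$ for $1\leq i\leq k$ and for each injective $J\in\mathrm{Mod}(\mathcal{C}/\mathcal{I})$.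
   Context: $\mathrm{Mod}(\mathcal{C})$ is the category of additive covariant functors $\mathcal{C}\to\mathbf{Ab}$. An ideal $\mathcal{I}$ of $\mathcal{C}$ is a family of subgroups $\mathcal{I}(A,B)\subseteq\mathrm{Hom}_{\mathcal{C}}(A,B)$ closed under composition on either side with arbitrary morphisms. $\mathcal{C}/\mathcal{I}$ has the same objects as $\mathcal{C}$ and $\mathrm{Hom}_{\mathcal{C}/\mathcal{I}}(A,B)=\mathrm{Hom}_{\mathcal{C}}(A,B)/\mathcal{I}(A,B)$; $\pi:\mathcal{C}\to\mathcal{C}/\mathcal{I}$ is the canonical functor and $\pi_{\ast}(F)=F\circ\pi$. $\varphi^{i}_{F,\pi_{\ast}(F')}$ denotes the canonical morphism on Ext groups induced by the exact functor $\pi_{\ast}$. $\mathcal{I}$ is $k$-idempotent if $\varphi^{i}_{F,\pi_{\ast}(F')}$ is an isomorphism for all $F,F'\in\mathrm{Mod}(\mathcal{C}/\mathcal{I})$ and all $0\leq i\leq k$. $\mathbb{EXT}^{i}_{\mathcal{C}}(\mathcal{C}/\mathcal{I},-):\mathrm{Mod}(\mathcal{C})\to\mathrm{Mod}(\mathcal{C}/\mathcal{I})$ is the $i$-th right derived functor of the functor $\mathcal{C}(\frac{\mathcal{C}}{\mathcal{I}},-)$ given by $\mathcal{C}(\frac{\mathcal{C}}{\mathcal{I}},M)(C)=\mathrm{Hom}_{\mathrm{Mod}(\mathcal{C})}\left(\frac{\mathrm{Hom}_{\mathcal{C}}(C,-)}{\mathcal{I}(C,-)},M\right)$; so $\mathbb{EXT}^{i}_{\mathcal{C}}(\mathcal{C}/\mathcal{I},M)(C)=\mathrm{Ext}^{i}_{\mathrm{Mod}(\mathcal{C})}\left(\frac{\mathrm{Hom}_{\mathcal{C}}(C,-)}{\mathcal{I}(C,-)},M\right)$.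 *)

(* Defs.v *)
From HB Require Import structures.
From mathcomp Require Import all_boot all_order all_algebra.
From mathcomp Require Import boolp classical_sets.

Set Implicit Arguments.
Unset Strict Implicit.
Unset Printing Implicit Defensive.

Import Order.TTheory GRing.Theory Num.Theory.
Local Open Scope classical_set_scope.
Local Open Scope ring_scope.
Local Open Scope quotient_scope.

Definition mk_additive (U V : zmodType) (f : U -> V) (fB : zmod_morphism f) :
  {additive U -> V} := HB.pack f (GRing.isZmodMorphism.Build U V f fB).

Definition mk_zmodClosed (U : zmodType) (S : {pred U}) (SB : zmod_closed S) :
  zmodClosed U := HB.pack (S : U -> bool) (GRing.isZmodClosed.Build U S SB).

Section QuotientLift.
Variables (U V : zmodType) (S : zmodClosed U) (f : {additive U -> V}).
Hypothesis fS : forall x, x \in S -> f x = 0.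

Definition qlift_fun (q : {ideal_quot S}) : V := f (repr q).

Lemma qlift_funE x : qlift_fun (\pi_{ideal_quot S} x) = f x.
Proof.
apply/eqP; rewrite -subr_eq0 -raddfB; apply/eqP/fS.
by rewrite Quotient.idealrBE reprK.
Qed.

Lemma qlift_funB : zmod_morphism qlift_fun.
Proof.
move=> x y; elim/quotP: x => x _; elim/quotP: y => y _.
by rewrite -raddfB !qlift_funE raddfB.
Qed.

Definition qlift : {additive {ideal_quot S} -> V} := mk_additive qlift_funB.

Lemma qliftE x : qlift (\pi_{ideal_quot S} x) = f x.
Proof. exact: qlift_funE. Qed.
End QuotientLift.

Lemma pi_eq0 (U : zmodType) (S : zmodClosed U) (x : U) :
  \pi_{ideal_quot S} x = 0 <-> x \in S.
Proof.
rewrite -[x in _ <-> x \in _]subr0 Quotient.idealrBE raddf0.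
by split=> [->|/eqP].
Qed.

(* Smallness is the requirement that the objects form a type: the universe
   of [obj] lies below that of the abelian groups in which modules take their
   values. *)
Record preadditive := Preadditive {
  obj :> Type;
  hom : obj -> obj -> zmodType;
  idm : forall A, hom A A;
  comp : forall A B D, hom B D -> hom A B -> hom A D;
  compA : forall A B D E (h : hom D E) (g : hom B D) (f : hom A B),
    comp h (comp g f) = comp (comp h g) f;
  comp1m : forall A B (f : hom A B), comp (idm B) f = f;
  compm1 : forall A B (f : hom A B), comp f (idm A) = f;
  compDl : forall A B D (g g' : hom B D) (f : hom A B),
    comp (g + g') f = comp g f + comp g' f;
  compDr : forall A B D (g : hom B D) (f f' : hom A B),
    comp g (f + f') = comp g f + comp g f' }.
Arguments idm {p} A.

Record addfunctor (C D : preadditive) := AddFunctor {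
  fobj :> C -> D;
  fmap : forall A B, {additive hom A B -> hom (fobj A) (fobj B)};
  fmap1 : forall A, fmap A A (idm A) = idm (fobj A);
  fmapM : forall A B E (g : hom B E) (f : hom A B),
    fmap A E (comp g f) = comp (fmap B E g) (fmap A B f) }.
Arguments fmap {C D} a {A B}.

(* The objects of Mod(C): additive covariant functors from C to Ab. *)
Record module (C : preadditive) := Module {
  mobj :> C -> zmodType;
  mact : forall A B, hom A B -> {additive mobj A -> mobj B};
  mactD : forall A B (f g : hom A B) x, mact (f + g) x = mact f x + mact g x;
  mact1 : forall A x, mact (idm A) x = x;
  mactM : forall A B D (g : hom B D) (f : hom A B) x,
    mact (comp g f) x = mact g (mact f x) }.
Arguments mact {C} m {A B}.

(* The morphisms of Mod(C): natural transformations. *)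
Record modhom (C : preadditive) (M N : module C) := ModHom {
  mapp :> forall A, {additive M A -> N A};
  mapp_nat : forall A B (f : hom A B) x,
    mapp B (mact M f x) = mact N f (mapp A x) }.

Section CompTheory.
Variable C : preadditive.
Implicit Types A B D : C.

Lemma compBl A B D (f : hom A B) : zmod_morphism (fun g : hom B D => comp g f).
Proof. by move=> g h; apply: (addIr (comp h f)); rewrite -compDl !subrK. Qed.

Lemma compBr A B D (g : hom B D) : zmod_morphism (fun f : hom A B => comp g f).
Proof. by move=> f h; apply: (addIr (comp g h)); rewrite -compDr !subrK. Qed.

Lemma comp0m A B D (f : hom A B) : comp (0 : hom B D) f = 0.
Proof. by rewrite -(subrr 0) compBl subrr. Qed.

Lemma compm0 A B D (g : hom B D) : comp g (0 : hom A B) = 0.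
Proof. by rewrite -(subrr 0) compBr subrr. Qed.
End CompTheory.

Section ModuleHoms.
Variable C : preadditive.
Implicit Types M N L : module C.

Lemma additive_ext (U V : zmodType) (f g : {additive U -> V}) :
  f =1 g -> f = g.
Proof.
case: f g => f [[fB] ] [g [[gB] ]] /= /funext fg.
by subst g; do 3!f_equal; exact: Prop_irrelevance.
Qed.

Lemma mactB M A B (x : M A) : zmod_morphism (fun f : hom A B => mact M f x).
Proof. by move=> f g; apply: (addIr (mact M g x)); rewrite -mactD !subrK. Qed.

Lemma modhomP M N (f g : modhom M N) : (forall A x, f A x = g A x) -> f = g.
Proof.
case: f g => f fN [g gN] /= fg.
have E : f = g by apply: functional_extensionality_dep => A; apply/additive_ext/fg.
by subst g; congr ModHom; exact: Prop_irrelevance.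
Qed.

Section Zmod.
Variables M N : module C.

HB.instance Definition _ := gen_eqMixin (modhom M N).
HB.instance Definition _ := gen_choiceMixin (modhom M N).

Lemma mh0_sub A : zmod_morphism (fun _ : M A => 0 : N A).
Proof. by move=> x y; rewrite subrr. Qed.
Lemma mhN_sub (f : modhom M N) A : zmod_morphism (fun x : M A => - f A x).
Proof. by move=> x y; rewrite raddfB opprD. Qed.
Lemma mhD_sub (f g : modhom M N) A : zmod_morphism (fun x : M A => f A x + g A x).
Proof. by move=> x y; rewrite !raddfB opprD addrACA. Qed.

Definition mh0 : modhom M N.
Proof.
by refine (@ModHom _ M N (fun A => mk_additive (@mh0_sub A)) _) => A B f x /=;
  rewrite raddf0.
Defined.
Definition mhN (f : modhom M N) : modhom M N.
Proof.
by refine (@ModHom _ M N (fun A => mk_additive (@mhN_sub f A)) _) => A B g x /=;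
  rewrite raddfN mapp_nat.
Defined.
Definition mhD (f g : modhom M N) : modhom M N.
Proof.
by refine (@ModHom _ M N (fun A => mk_additive (@mhD_sub f g A)) _) => A B h x /=;
  rewrite raddfD !mapp_nat.
Defined.

Lemma mhDA : associative mhD.
Proof. by move=> f g h; apply: modhomP => A x /=; rewrite addrA. Qed.
Lemma mhDC : commutative mhD.
Proof. by move=> f g; apply: modhomP => A x /=; rewrite addrC. Qed.
Lemma mhD0 : left_id mh0 mhD.
Proof. by move=> f; apply: modhomP => A x /=; rewrite add0r. Qed.
Lemma mhDN : left_inverse mh0 mhN mhD.
Proof. by move=> f; apply: modhomP => A x /=; rewrite addNr. Qed.

HB.instance Definition _ :=
  GRing.isZmodule.Build (modhom M N) mhDA mhDC mhD0 mhDN.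
End Zmod.

Lemma mappD M N (f g : modhom M N) A x : (f + g) A x = f A x + g A x.
Proof. by []. Qed.
Lemma mapp0 M N A x : (0 : modhom M N) A x = 0.
Proof. by []. Qed.
Lemma mappN M N (f : modhom M N) A x : (- f) A x = - f A x.
Proof. by []. Qed.

Definition mhid M : modhom M M.
Proof. by refine (@ModHom _ M M (fun A => idfun) _). Defined.

Definition mhcomp M N L (g : modhom N L) (f : modhom M N) : modhom M L.
Proof.
by refine (@ModHom _ M L (fun A => g A \o f A) _) => A B h x /=; rewrite !mapp_nat.
Defined.

Lemma mhcompA M N L K (h : modhom L K) (g : modhom N L) (f : modhom M N) :
  mhcomp h (mhcomp g f) = mhcomp (mhcomp h g) f.
Proof. exact: modhomP. Qed.

Lemma mhcompBl M N L (f : modhom M N) :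
  zmod_morphism (fun g : modhom N L => mhcomp g f).
Proof. by move=> g h; apply: modhomP. Qed.
Lemma mhcompBr M N L (g : modhom N L) :
  zmod_morphism (fun f : modhom M N => mhcomp g f).
Proof. by move=> f h; apply: modhomP => A x /=; rewrite raddfB. Qed.

Definition postcomp M N L (g : modhom N L) :
  {additive modhom M N -> modhom M L} := mk_additive (@mhcompBr M N L g).
Definition precomp M N L (f : modhom M N) :
  {additive modhom N L -> modhom M L} := mk_additive (@mhcompBl M N L f).

Definition mono M N (f : modhom M N) : Prop :=
  forall L (u v : modhom L M), mhcomp f u = mhcomp f v -> u = v.

Definition injective_module J : Prop :=
  forall M N (i : modhom M N) (f : modhom M J), mono i ->
    exists g : modhom N J, mhcomp g i = f.

(* Hom_C(A, -) *)
Definition rep (A : C) : module C.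
Proof.
by refine (@Module C (fun B => hom A B)
             (fun B D f => mk_additive (@compBr C A B D f)) _ _ _) => *;
  rewrite /= ?compDl ?comp1m -?compA.
Defined.

Definition rep_map (A B : C) (f : hom A B) : modhom (rep B) (rep A).
Proof.
by refine (@ModHom _ (rep B) (rep A) (fun D => mk_additive (@compBl C A B D f)) _) => *;
  rewrite /= compA.
Defined.
End ModuleHoms.

Section Restriction.
Variables (C D : preadditive) (P : addfunctor C D).

(* F \o P *)
Definition pull (F : module D) : module C.
Proof.
by refine (@Module C (fun A => F (P A)) (fun A B f => mact F (fmap P f)) _ _ _) => *;
  rewrite /= ?raddfD ?mactD ?fmap1 ?mact1 ?fmapM ?mactM.
Defined.

Definition pull_hom (F G : module D) (f : modhom F G) : modhom (pull F) (pull G).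
Proof.
by refine (@ModHom C (pull F) (pull G) (fun A => f (P A)) _) => *; rewrite /= mapp_nat.
Defined.
End Restriction.

Record ideal (C : preadditive) := Ideal {
  imem :> forall A B : C, zmodClosed (hom A B);
  ideal_compl : forall (A B D : C) (g : hom B D) (f : hom A B),
    f \in imem A B -> comp g f \in imem A D;
  ideal_compr : forall (A B D : C) (g : hom B D) (f : hom A B),
    g \in imem B D -> comp g f \in imem A D }.

Section QuotientCategory.
Variables (C : preadditive) (I : ideal C).

Definition qhom (A B : C) : zmodType := {ideal_quot I A B}.
Definition qpi (A B : C) : {additive hom A B -> qhom A B} := \pi_{ideal_quot I A B}.
Definition qcomp (A B D : C) (g : qhom B D) (f : qhom A B) : qhom A D :=
  qpi A D (comp (repr g) (repr f)).

Lemma qpiK (A B : C) (f : qhom A B) : qpi A B (repr f) = f.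
Proof. exact: reprK. Qed.

Lemma qpi_eq (A B : C) (f g : hom A B) : f - g \in I A B -> qpi A B f = qpi A B g.
Proof. by rewrite Quotient.idealrBE => /eqP. Qed.

Lemma repr_qpi (A B : C) (f : hom A B) : f - repr (qpi A B f) \in I A B.
Proof. by rewrite Quotient.idealrBE reprK. Qed.

Lemma qcompE (A B D : C) (g : hom B D) (f : hom A B) :
  qcomp (qpi B D g) (qpi A B f) = qpi A D (comp g f).
Proof.
apply/esym/qpi_eq; rewrite -(subrKA (comp g (repr (qpi A B f)))).
rewrite -(@compBr C) -(@compBl C).
by apply: rpredD; [apply: ideal_compl|apply: ideal_compr]; exact: repr_qpi.
Qed.

Definition quotcat : preadditive.
Proof.
refine (@Preadditive (obj C) qhom (fun A => qpi A A (idm A)) qcomp _ _ _ _ _).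
- move=> A B D E h g f.
  by rewrite -(qpiK h) -(qpiK g) -(qpiK f) !qcompE compA.
- by move=> A B f; rewrite -(qpiK f) qcompE comp1m.
- by move=> A B f; rewrite -(qpiK f) qcompE compm1.
- move=> A B D g g' f.
  by rewrite -(qpiK g) -(qpiK g') -(qpiK f) -raddfD !qcompE compDl raddfD.
- move=> A B D g f f'.
  by rewrite -(qpiK g) -(qpiK f) -(qpiK f') -raddfD !qcompE compDr raddfD.
Defined.

Definition quotfun : addfunctor C quotcat.
Proof.
refine (@AddFunctor C quotcat id qpi _ _) => // A B D g f.
by rewrite [RHS]qcompE.
Defined.
End QuotientCategory.

Record cochain := Cochain {
  cobj :> nat -> zmodType;
  cdiff : forall n, {additive cobj n -> cobj n.+1};
  cdiffK : forall n x, cdiff n.+1 (cdiff n x) = 0 }.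

Record cochain_map (X Y : cochain) := CochainMap {
  cmap :> forall n, {additive X n -> Y n};
  cmap_diff : forall n x, cmap n.+1 (cdiff X n x) = cdiff Y n (cmap n x) }.

Section Cohomology.
Variable X : cochain.

Definition cocycle_pred n : {pred X n} := [pred x | cdiff X n x == 0].
Arguments cocycle_pred : clear implicits.

Lemma cocycle_sub n : zmod_closed (cocycle_pred n).
Proof.
split=> [|x y]; rewrite !inE; first by rewrite raddf0.
by rewrite raddfB => /eqP-> /eqP->; rewrite subrr.
Qed.
HB.instance Definition _ n :=
  GRing.isZmodClosed.Build (X n) (cocycle_pred n) (cocycle_sub n).

Record cocycle n := Cocycle { cocycle_val :> X n; _ : cocycle_val \in cocycle_pred n }.
HB.instance Definition _ n := [isSub for @cocycle_val n].
HB.instance Definition _ n := [Choice of cocycle n by <:].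
HB.instance Definition _ n := [SubChoice_isSubZmodule of cocycle n by <:].

Lemma cocycleP n (z : cocycle n) : cdiff X n (val z) = 0.
Proof. exact/eqP/(valP z). Qed.

(* X has no term in degree -1, so 0 is the only coboundary of degree 0. *)
Definition is_coboundary n : X n -> Prop :=
  match n return X n -> Prop with
  | 0 => fun x => x = 0
  | m.+1 => fun x => exists y, cdiff X m y = x
  end.

Definition coboundary_pred n : {pred cocycle n} :=
  [pred z | `[< is_coboundary (val z) >]].

Lemma coboundary_sub n : zmod_closed (@coboundary_pred n).
Proof.
split=> [|x y]; rewrite !inE.
  by rewrite raddf0; case: n => [|n] //=; exists 0; rewrite raddf0.
rewrite raddfB; case: n x y => [|n] x y /=; first by move=> -> ->; rewrite subrr.
by move=> [a ax] [b byy]; exists (a - b); rewrite raddfB ax byy.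
Qed.

Definition coboundary n : zmodClosed (cocycle n) := mk_zmodClosed (@coboundary_sub n).

Definition cohom n : zmodType := {ideal_quot coboundary n}.

Definition cohom_class n : {additive cocycle n -> cohom n} := \pi_{ideal_quot coboundary n}.

Lemma cohom_classP n (h : cohom n) : exists z, h = cohom_class n z.
Proof. by exists (repr h); rewrite /cohom_class /= reprK. Qed.

Lemma cohom_class0 n (z : cocycle n) : cohom_class n z = 0 <-> is_coboundary (val z).
Proof. by rewrite /cohom_class /= pi_eq0; split=> /asboolP. Qed.
End Cohomology.
Arguments cocycle_pred : clear implicits.

Section CohomologyMap.
Variables (X Y : cochain) (f : cochain_map X Y) (n : nat).

Lemma cocycle_map_sub (z : cocycle X n) : f n (val z) \in cocycle_pred Y n.
Proof. by rewrite inE -cmap_diff cocycleP raddf0. Qed.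

Definition cocycle_map_fun (z : cocycle X n) : cocycle Y n :=
  Cocycle (cocycle_map_sub z).

Lemma cocycle_map_funB : zmod_morphism cocycle_map_fun.
Proof. by move=> x y; apply: val_inj; rewrite /= !raddfB. Qed.

Definition cocycle_map : {additive cocycle X n -> cocycle Y n} :=
  mk_additive cocycle_map_funB.

Lemma cocycle_map_coboundary z :
  z \in coboundary X n -> cohom_class Y n (cocycle_map z) = 0.
Proof.
move=> /asboolP zB; apply/cohom_class0; move: zB; rewrite /=.
case: n z => [|m] z /=; first by move=> ->; rewrite raddf0.
by move=> [y <-]; exists (f m y); rewrite cmap_diff.
Qed.

Definition cohom_map : {additive cohom X n -> cohom Y n} :=
  qlift (f := cohom_class Y n \o cocycle_map) cocycle_map_coboundary.

Lemma cohom_mapE z : cohom_map (cohom_class X n z) = cohom_class Y n (cocycle_map z).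
Proof. exact: qliftE. Qed.
End CohomologyMap.

Section Resolutions.
Variable C : preadditive.

Record coresolution (M : module C) := Coresolution {
  cr_obj :> nat -> module C;
  cr_aug : modhom M (cr_obj 0);
  cr_diff : forall n, modhom (cr_obj n) (cr_obj n.+1);
  cr_aug_inj : forall A, injective (cr_aug A);
  cr_exact0 : forall A x, cr_diff 0 A x = 0 <-> exists y, cr_aug A y = x;
  cr_exactS : forall n A x,
    cr_diff n.+1 A x = 0 <-> exists y, cr_diff n A y = x }.

Record injres (M : module C) := InjRes {
  ir_cores :> coresolution M;
  ir_inj : forall n, injective_module (ir_cores n) }.

Section QuotientModule.
Variables (M : module C) (S : forall A, zmodClosed (M A)).
Hypothesis S_act : forall A B (f : hom A B) x, x \in S A -> mact M f x \in S B.

Definition mpi A : {additive M A -> {ideal_quot S A}} := \pi_{ideal_quot S A}.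

Lemma mpiP A (q : {ideal_quot S A}) : exists x, q = mpi A x.
Proof. by exists (repr q); rewrite /mpi /= reprK. Qed.

Lemma qact_sub A B (f : hom A B) x : x \in S A -> mpi B (mact M f x) = 0.
Proof. by move=> xS; apply/pi_eq0/S_act. Qed.

Definition qact A B (f : hom A B) : {additive {ideal_quot S A} -> {ideal_quot S B}} :=
  qlift (f := mpi B \o mact M f) (@qact_sub A B f).

Lemma qactE A B (f : hom A B) x : qact f (mpi A x) = mpi B (mact M f x).
Proof. exact: qliftE. Qed.

Definition quotmod : module C.
Proof.
refine (@Module C (fun A => {ideal_quot S A}) qact _ _ _).
- by move=> A B f g q; have [x ->] := mpiP q; rewrite !qactE mactD raddfD.
- by move=> A q; have [x ->] := mpiP q; rewrite !qactE mact1.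
- by move=> A B D g f q; have [x ->] := mpiP q; rewrite (qactE f) (qactE g) qactE mactM.
Defined.

Definition quotmod_pi : modhom M quotmod.
Proof. by refine (@ModHom C M quotmod mpi _) => A B f x; rewrite [RHS]qactE. Defined.

Lemma quotmod_pi0 A x : quotmod_pi A x = 0 <-> x \in S A.
Proof. exact: pi_eq0. Qed.

Lemma quotmod_piP A (q : quotmod A) : exists x, q = quotmod_pi A x.
Proof. exact: mpiP. Qed.

Section Lift.
Variables (N : module C) (g : modhom M N).
Hypothesis gS : forall A x, x \in S A -> g A x = 0.

Definition quotmod_lift : modhom quotmod N.
Proof.
refine (@ModHom C quotmod N (fun A => qlift (@gS A)) _) => A B f q.
by have [x ->] := mpiP q; rewrite qactE !qliftE mapp_nat.
Defined.

Lemma quotmod_liftE A x : quotmod_lift A (quotmod_pi A x) = g A x.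
Proof. exact: qliftE. Qed.
End Lift.
End QuotientModule.

Lemma mono_of_inj (M N : module C) (f : modhom M N) :
  (forall A, injective (f A)) -> mono f.
Proof.
move=> fI L u v uv; apply: modhomP => A x; apply: (fI A).
by have := congr1 (fun h : modhom L N => h A x) uv.
Qed.

Section KerIm.
Variables (M N : module C) (f : modhom M N).

Definition ker_pred A : {pred M A} := [pred x | f A x == 0].
Definition im_pred A : {pred N A} := [pred y | `[< exists x, f A x = y >]].
Arguments ker_pred : clear implicits.
Arguments im_pred : clear implicits.

Lemma ker_sub A : zmod_closed (ker_pred A).
Proof.
split=> [|x y]; rewrite !inE; first by rewrite raddf0.
by rewrite raddfB => /eqP-> /eqP->; rewrite subrr.
Qed.
Lemma im_sub A : zmod_closed (im_pred A).
Proof.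
split=> [|x y]; rewrite !inE; first by exists 0; rewrite raddf0.
by move=> [a <-] [b <-]; exists (a - b); rewrite raddfB.
Qed.
Definition ker_closed A := mk_zmodClosed (ker_sub A).
Definition im_closed A := mk_zmodClosed (im_sub A).
Lemma ker_act A B (h : hom A B) x : x \in ker_closed A -> mact M h x \in ker_closed B.
Proof. by rewrite !inE /= mapp_nat => /eqP->; rewrite raddf0. Qed.
Lemma im_act A B (h : hom A B) y : y \in im_closed A -> mact N h y \in im_closed B.
Proof. by move=> /asboolP[x <-]; apply/asboolP; exists (mact M h x); rewrite mapp_nat. Qed.

Definition coimage : module C := quotmod ker_act.
Definition coker : module C := quotmod im_act.
Definition coker_pi : modhom N coker := quotmod_pi im_act.

Lemma coker_pi0 A y : coker_pi A y = 0 <-> exists x, f A x = y.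
Proof. by rewrite quotmod_pi0; split=> /asboolP. Qed.
End KerIm.

Lemma injective_extend (M N J : module C) (d : modhom M N) (g : modhom M J) :
  injective_module J -> (forall A x, d A x = 0 -> g A x = 0) ->
  exists h : modhom N J, mhcomp h d = g.
Proof.
move=> Jinj dg.
have kd A x : x \in ker_closed d A -> d A x = 0 by move=> /eqP.
have kg A x : x \in ker_closed d A -> g A x = 0 by move=> /kd/dg.
pose d' : modhom (coimage d) N := quotmod_lift (@ker_act _ _ d) kd.
pose g' : modhom (coimage d) J := quotmod_lift (@ker_act _ _ d) kg.
have d'M : mono d'.
  apply: mono_of_inj => A; apply: raddf_inj => q.
  have [x ->] := quotmod_piP q; rewrite quotmod_liftE => dx.
  by apply/quotmod_pi0/eqP.
have [h hd] := Jinj _ _ _ g' d'M; exists h; apply: modhomP => A x /=.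
by rewrite -(quotmod_liftE (@ker_act _ _ d) kd) -(quotmod_liftE (@ker_act _ _ d) kg)
  -/g' -hd.
Qed.

Lemma cr_diff_aug (M : module C) (X : coresolution M) A x :
  cr_diff X 0 A (cr_aug X A x) = 0.
Proof. by apply/cr_exact0; exists x. Qed.

Lemma cr_diffK (M : module C) (X : coresolution M) n A x :
  cr_diff X n.+1 A (cr_diff X n A x) = 0.
Proof. by apply/cr_exactS; exists x. Qed.

(* A morphism of complexes lifting the identity of M. *)
Record res_map (M : module C) (X Y : coresolution M) := ResMap {
  rmap :> forall n, modhom (X n) (Y n);
  rmap_aug : mhcomp (rmap 0) (cr_aug X) = cr_aug Y;
  rmap_diff : forall n,
    mhcomp (rmap n.+1) (cr_diff X n) = mhcomp (cr_diff Y n) (rmap n) }.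

Lemma comparison_exists (M : module C) (X : coresolution M) (Y : injres M) :
  exists _ : res_map X Y, True.
Proof.
pose P n (c : modhom (X n) (Y n)) :=
  forall A x, cr_diff X n A x = 0 -> cr_diff Y n A (c A x) = 0.
have [c0 c0E] : exists c : modhom (X 0%N) (Y 0%N), mhcomp c (cr_aug X) = cr_aug Y.
  apply: injective_extend; first exact: ir_inj.
  by move=> A x; rewrite -(raddf0 (cr_aug X A)) => /cr_aug_inj ->; rewrite raddf0.
have E0 A x : c0 A (cr_aug X A x) = cr_aug Y A x by rewrite -c0E.
have P0 : P 0%N c0.
  by move=> A x /cr_exact0[y <-]; rewrite E0 cr_diff_aug.
have step n (c : {c | P n c}) : {c' : {c' | P n.+1 c'} |
    mhcomp (sval c') (cr_diff X n) = mhcomp (cr_diff Y n) (sval c)}.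
  case: c => c Pc /=.
  have /cid[c' c'E] : exists c' : modhom (X n.+1) (Y n.+1),
      mhcomp c' (cr_diff X n) = mhcomp (cr_diff Y n) c.
    by apply: injective_extend; [exact: ir_inj|move=> A x /Pc].
  have E A x : c' A (cr_diff X n A x) = cr_diff Y n A (c A x).
    by have := congr1 (fun h : modhom (X n) (Y n.+1) => h A x) c'E.
  have Pc' : P n.+1 c' by move=> A x /cr_exactS[y <-]; rewrite E cr_diffK.
  by exists (exist _ c' Pc').
pose s := fix s n : {c | P n c} :=
  match n with 0 => exist _ c0 P0 | m.+1 => sval (step m (s m)) end.
by exists (@ResMap M X Y (fun n => sval (s n)) c0E (fun n => svalP (step n (s n)))).
Qed.

Definition comparison (M : module C) (X : coresolution M) (Y : injres M) :
  res_map X Y := sval (cid (comparison_exists X Y)).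

End Resolutions.

Definition pull_cores (C D : preadditive) (P : addfunctor C D) (F : module D)
  (X : coresolution F) : coresolution (pull P F).
Proof.
refine (@Coresolution C (pull P F) (fun n => pull P (X n))
  (pull_hom P (cr_aug X)) (fun n => pull_hom P (cr_diff X n)) _ _ _).
- by move=> A; exact: cr_aug_inj.
- by move=> A; exact: cr_exact0.
- by move=> n A; exact: cr_exactS.
Defined.

(* Mod(C) has enough injectives: every module embeds into a product of modules
   Hom_Z(Hom_C(-, A), Q/Z), and Q/Z is injective because it is divisible. *)
Lemma mulrz_divmod (U : zmodType) (x : U) (m : int) (n : nat) :
  x *~ m = x *+ n *~ (m %/ n)%Z + x *~ (m %% n)%Z.
Proof.
have := divz_eq m n; move: (m %/ n)%Z (m %% n)%Z => a b ->.
by rewrite mulrzDr mulrC mulrzA.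
Qed.

Section DivisibleExtension.
Variables (G Q : zmodType).
Hypothesis Qdiv : forall (n : nat) (q : Q), exists r, r *+ n.+1 = q.

(* Graphs of homomorphisms from a subgroup of G to Q. *)
Let partial_hom (R : set (G * Q)) : Prop :=
  [/\ R 0, forall u v, R u -> R v -> R (u - v) & forall q, R (0, q) -> q = 0].

Lemma partial_homZ R (m : int) (u : G * Q) :
  partial_hom R -> R u -> R (u.1 *~ m, u.2 *~ m).
Proof.
move=> [R0 RB _] Ru.
have RN v : R v -> R (- v) by move=> Rv; rewrite -sub0r; exact: RB.
have Rn (n : nat) : R (u.1 *+ n, u.2 *+ n).
  elim: n => [|n IH]; first by [].
  have := RB _ _ Ru (RN _ IH).
  by rewrite opprK !mulrS.
by case: m => n; [exact: Rn|exact: (RN _ (Rn n.+1))].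
Qed.

Lemma partial_hom_ext R (x : G) :
  partial_hom R -> exists q, partial_hom
    [set u | exists y s (m : int), R (y, s) /\ u = (y + x *~ m, s + q *~ m)].
Proof.
move=> hR; have [R0 RB Rf] := hR.
suff [q qP] : exists q, forall (m : int) s, R (x *~ m, s) -> s = q *~ m.
  exists q; split.
  - by exists 0, 0, 0; split; [exact: R0|rewrite !mulr0z !addr0].
  - move=> _ _ [y [s [m [Ry ->]]]] [y' [s' [m' [Ry' ->]]]].
    exists (y - y'), (s - s'), (m - m'); split; first exact: (RB _ _ Ry Ry').
    rewrite [LHS]/(_ - _) /=; congr (_, _) => /=;
    by rewrite /= mulrzBr opprD addrACA.
  - move=> q0 [y [s [m [Ry [y0 ->]]]]].
    have yE : y = x *~ (- m) by rewrite mulrNz; apply/eqP; rewrite -addr_eq0 -y0.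
    by rewrite yE in Ry; rewrite (qP _ _ Ry) mulrNz addNr.
have [[n0 n0P]|nex] := pselect (exists n : nat, `[< exists s, R (x *+ n.+1, s) >]).
  have ex : exists n : nat, `[< exists s, R (x *+ n.+1, s) >] by exists n0.
  case: (ex_minnP ex) => n /asboolP[r Rr] nmin {n0 n0P ex}.
  have [q qr] := Qdiv n r; exists q => m s Rm.
  have Rb : R (x *~ (m %% n.+1)%Z, s - r *~ (m %/ n.+1)%Z).
    rewrite (_ : x *~ _ = x *~ m - x *+ n.+1 *~ (m %/ n.+1)%Z).
      exact: (RB _ _ Rm (partial_homZ (m %/ n.+1)%Z hR Rr)).
    by rewrite (mulrz_divmod x m n.+1) addrAC subrr add0r.
  have : (0 <= (m %% n.+1)%Z)%R by apply: modz_ge0.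
  have : ((m %% n.+1)%Z < n.+1)%R by apply: ltz_pmod.
  rewrite (mulrz_divmod q m n.+1) qr.
  case: (m %% n.+1)%Z Rb => [[|b]|b] //= Rb bn _.
    by rewrite addr0; apply/eqP; rewrite -subr_eq0; apply/eqP/Rf.
  have /nmin : `[< exists s, R (x *+ b.+1, s) >].
    by apply/asboolP; exists (s - r *~ (m %/ n.+1)%Z).
  by rewrite leqNgt; move: bn; rewrite ltz_nat ltnS => ->.
exists 0 => -[[|n]|n] s Rs; rewrite ?mul0rz.
- exact: Rf.
- by case: nex; exists n; apply/asboolP; exists s.
- case: nex; exists n; apply/asboolP; exists (- s).
  by have := partial_homZ (- 1) hR Rs; rewrite /= !mulrN1z NegzE mulrNz opprK.
Qed.

Lemma divisible_extend (R0 : set (G * Q)) : partial_hom R0 ->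
  exists f : {additive G -> Q}, forall x q, R0 (x, q) -> f x = q.
Proof.
move=> hR0.
pose P : set (set (G * Q)) := [set A | partial_hom (A `|` R0)].
have [F FP Ftot|A [PA Amax]] := @Zorn_bigcup _ P.
  have common u v : (\bigcup_(X in F) X `|` R0) u -> (\bigcup_(X in F) X `|` R0) v ->
      exists2 S, partial_hom S & [/\ S u, S v & S `<=` \bigcup_(X in F) X `|` R0].
    have sub X : F X -> X `|` R0 `<=` \bigcup_(X in F) X `|` R0.
      by move=> FX w [Xw|]; [left; exists X|right].
    move=> [[X FX Xu]|Ru] [[Y FY Yv]|Rv].
    - have [XY|YX] := Ftot _ _ FX FY.
        exists (Y `|` R0); first exact: FP.
        by split; [left; exact: XY|left|exact: sub].
      exists (X `|` R0); first exact: FP.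
      by split; [left|left; exact: YX|exact: sub].
    - by exists (X `|` R0); [exact: FP|split; [left|right|exact: sub]].
    - by exists (Y `|` R0); [exact: FP|split; [right|left|exact: sub]].
    - by exists R0 => //; split => // w; right.
  split.
  - by right; case: hR0.
  - by move=> u v hu hv; have [S [_ SB _] [Su Sv sub]] := common _ _ hu hv; exact/sub/SB.
  - by move=> q hq; have [S [_ _ Sf] [Su _ _]] := common _ _ hq hq; exact: Sf.
set R := A `|` R0 in PA *.
have Rtot x : exists q, R (x, q).
  have [q hq] := partial_hom_ext x PA.
  set R' := (X in partial_hom X) in hq.
  have RR' : R `<=` R'.
    by move=> [y s] Ry; exists y, s, 0; rewrite !mulr0z !addr0.
  have R'x : R' (x, q).
    by exists 0, 0, 1; rewrite !mulr1z !add0r; split => //; case: PA.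
  apply: contrapT => nx; apply: (Amax R').
    split=> [w Aw|]; first by apply: RR'; left.
    by move=> /(_ _ R'x) Ax; apply: nx; exists q; left.
  rewrite /P /= setUidl // => w wR0; apply: RR'; by right.
have [_ RB Rf] := PA.
pose f x := sval (cid (Rtot x)).
have fR x : R (x, f x) := svalP (cid (Rtot x)).
have fE x q : R (x, q) -> f x = q.
  move=> Rq; apply/eqP; rewrite -subr_eq0; apply/eqP/Rf.
  by rewrite -(subrr x); exact: (RB _ _ (fR x) Rq).
have fB : zmod_morphism f by move=> x y; exact/fE/(RB _ _ (fR x) (fR y)).
by exists (mk_additive fB) => x q Rq; apply: fE; right.
Qed.
End DivisibleExtension.

Lemma rat_int_sub : zmod_closed (mem (Num.int : {pred rat})).
Proof. by split=> [|x y]; [exact: rpred0|exact: rpredB]. Qed.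

Definition QZ : zmodType := {ideal_quot (mk_zmodClosed rat_int_sub)}.

Section QZInjective.
Let qz : {additive rat -> QZ} := \pi_{ideal_quot (mk_zmodClosed rat_int_sub)}.

Lemma QZ_div (n : nat) (q : QZ) : exists r, r *+ n.+1 = q.
Proof.
exists (qz (repr q / n.+1%:R)); rewrite -raddfMn -[_ / _ *+ _]mulr_natr divfK ?pnatr_eq0 //.
exact: reprK.
Qed.

Lemma QZ_extend (G H : zmodType) (i : {additive H -> G}) (f : {additive H -> QZ}) :
  injective i -> exists g : {additive G -> QZ}, forall x, g (i x) = f x.
Proof.
move=> iI.
have [|g gP] := @divisible_extend G QZ QZ_div [set u | exists x, u = (i x, f x)].
- split.
  + by exists 0; rewrite !raddf0.
  + by move=> _ _ [x ->] [y ->]; exists (x - y); rewrite !raddfB.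
  + by move=> q [x [x0 ->]]; have -> : x = 0 by [apply: iI; rewrite raddf0]; rewrite raddf0.
by exists g => x; apply: gP; exists x.
Qed.

Lemma QZ_separates (G : zmodType) (x : G) : x != 0 ->
  exists f : {additive G -> QZ}, f x != 0.
Proof.
move=> x0.
have [n n1 nP] : exists2 n : nat, (1 < n)%N &
    forall m : int, x *~ m = 0 -> (n %| m)%Z.
  have [[n0 n0P]|nex] := pselect (exists n : nat, x *+ n.+1 == 0).
    have ex : exists n : nat, x *+ n.+1 == 0 by exists n0.
    case: (ex_minnP ex) => n /eqP nx nmin {n0 n0P ex}.
    exists n.+1; first by case: n nx nmin => // /eqP; rewrite (negPf x0).
    move=> m mx; have : x *~ (m %% n.+1)%Z = 0.
      by move: mx; rewrite (mulrz_divmod x m n.+1) nx mul0rz add0r.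
    have b0 : (0 <= (m %% n.+1)%Z)%R by apply: modz_ge0.
    have bn : ((m %% n.+1)%Z < n.+1)%R by apply: ltz_pmod.
    move=> bx; apply/dvdz_mod0P; case: (m %% n.+1)%Z b0 bn bx => [[|b]|b] // _ bn bx.
    have /nmin : x *+ b.+1 == 0 by apply/eqP.
    by rewrite leqNgt -ltnS -ltz_nat bn.
  exists 2%N => //; case=> [[|n]|n] // nx; case: nex; exists n; first exact/eqP.
  by move: nx; rewrite NegzE mulrNz => /eqP; rewrite oppr_eq0.
pose R0 : set (G * QZ) := [set u | exists m : int, u = (x *~ m, qz (m%:~R / n%:~R))].
have [|f fP] := @divisible_extend G QZ QZ_div R0.
- split.
  + by exists 0; rewrite mulr0z mul0r raddf0.
  + by move=> _ _ [m ->] [m' ->]; exists (m - m'); rewrite mulrzBr intrB mulrBl raddfB.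
  + by move=> q [m [/esym/nP nm ->]]; apply/pi_eq0; exact: (Qint_dvdz nm).
exists f; rewrite (fP x (qz (1%:~R / n%:~R))); last by exists 1; rewrite mulr1z.
apply/eqP => /pi_eq0 nI.
have /intrP[m] : (1%:~R / n%:~R : rat) \is a Num.int by exact: nI.
rewrite div1r => nm.
have n0 : n%:~R != 0 :> rat by rewrite pnatr_eq0 -lt0n (ltn_trans _ n1).
have : (m * n)%:~R = 1%:~R :> rat.
  by rewrite intrM -nm mulVf.
move=> /intr_inj /(congr1 absz); rewrite abszM => mn.
have : (n %| 1)%N by apply/dvdnP; exists `|m|%N; rewrite -[LHS]mn.
by rewrite dvdn1 => /eqP nE; rewrite nE in n1.
Qed.
End QZInjective.

Section EnoughInjectives.
Variable C : preadditive.

Section Cofree.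
Variable M : module C.

(* B |-> \prod_(A, chi : M A -> Q/Z) Hom_Z(Hom_C(B, A), Q/Z) *)
Record cofree (B : C) := Cofree {
  cofree_val : forall A : C, {additive M A -> QZ} -> hom B A -> QZ;
  cofreeB : forall A chi, zmod_morphism (@cofree_val A chi) }.

Lemma cofreeP B (u v : cofree B) :
  (forall A chi a, cofree_val u (A := A) chi a = cofree_val v chi a) -> u = v.
Proof.
case: u v => u uB [v vB] /= uv.
have E : u = v.
  by do 3![apply: functional_extensionality_dep => ?]; exact: uv.
by subst v; congr Cofree; exact: Prop_irrelevance.
Qed.

HB.instance Definition _ B := gen_eqMixin (cofree B).
HB.instance Definition _ B := gen_choiceMixin (cofree B).

Section Zmod.
Variable B : C.

Definition cofree0 : cofree B.
Proof. by refine (@Cofree B (fun _ _ _ => 0) _) => A chi f g; rewrite subrr. Defined.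
Definition cofreeN (u : cofree B) : cofree B.
Proof.
refine (@Cofree B (fun A chi a => - cofree_val u chi a) _) => A chi f g.
by rewrite cofreeB opprD.
Defined.
Definition cofreeD (u v : cofree B) : cofree B.
Proof.
refine (@Cofree B (fun A chi a => cofree_val u chi a + cofree_val v chi a) _) => A chi f g.
by rewrite !cofreeB opprD addrACA.
Defined.

Lemma cofreeDA : associative cofreeD.
Proof. by move=> u v w; apply: cofreeP => A chi a /=; rewrite addrA. Qed.
Lemma cofreeDC : commutative cofreeD.
Proof. by move=> u v; apply: cofreeP => A chi a /=; rewrite addrC. Qed.
Lemma cofreeD0 : left_id cofree0 cofreeD.
Proof. by move=> u; apply: cofreeP => A chi a /=; rewrite add0r. Qed.
Lemma cofreeDN : left_inverse cofree0 cofreeN cofreeD.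
Proof. by move=> u; apply: cofreeP => A chi a /=; rewrite addNr. Qed.

HB.instance Definition _ :=
  GRing.isZmodule.Build (cofree B) cofreeDA cofreeDC cofreeD0 cofreeDN.
End Zmod.

Section Act.
Variables (B D : C) (f : hom B D).

Definition cofree_act_fun (u : cofree B) : cofree D.
Proof.
refine (@Cofree D (fun A chi a => cofree_val u chi (comp a f)) _) => A chi a b.
by rewrite (compBl f) cofreeB.
Defined.
Lemma cofree_act_funB : zmod_morphism cofree_act_fun.
Proof. by move=> u v; exact: cofreeP. Qed.
Definition cofree_act : {additive cofree B -> cofree D} := mk_additive cofree_act_funB.
End Act.

Definition cofree_module : module C.
Proof.
refine (@Module C (fun B => cofree B) cofree_act _ _ _).
- move=> A B f g u; apply: cofreeP => D chi a /=; rewrite compDr.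
  exact: (raddfD (mk_additive (@cofreeB _ u D chi))).
- by move=> A u; apply: cofreeP => D chi a /=; rewrite compm1.
- by move=> A B D g f u; apply: cofreeP => E chi a /=; rewrite compA.
Defined.

Definition cofree_emb_fun (B : C) (x : M B) : cofree B.
Proof.
refine (@Cofree B (fun A chi a => chi (mact M a x)) _) => A chi f g.
by rewrite (mactB x) raddfB.
Defined.
Lemma cofree_emb_funB B : zmod_morphism (@cofree_emb_fun B).
Proof. by move=> x y; apply: cofreeP => A chi a /=; rewrite !raddfB. Qed.

Definition cofree_emb : modhom M cofree_module.
Proof.
refine (@ModHom C M cofree_module (fun B => mk_additive (@cofree_emb_funB B)) _).
by move=> A B f x; apply: cofreeP => D chi a /=; rewrite mactM.
Defined.

Lemma cofree_emb_inj A : injective (cofree_emb A).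
Proof.
apply: raddf_inj => x x0; apply/eqP/negPn/negP => /QZ_separates[chi].
have := congr1 (fun u : cofree A => cofree_val u chi (idm A)) x0.
by rewrite /= mact1 => ->; rewrite eqxx.
Qed.
End Cofree.

Lemma mono_inj (M N : module C) (i : modhom M N) : mono i -> forall A, injective (i A).
Proof.
move=> iM A; apply: raddf_inj => x ix.
have yonN (y : M A) B D (g : hom B D) (f : hom A B) :
  mact M (comp g f) y = mact M g (mact M f y) by rewrite mactM.
pose yon y := @ModHom C (rep A) M (fun B => mk_additive (@mactB C M A B y)) (yonN y).
have : yon x = yon 0.
  by apply: iM; apply: modhomP => B f /=; rewrite !mapp_nat ix !raddf0.
by move=> /(congr1 (fun h : modhom (rep A) M => h A (idm A))) /=; rewrite !mact1.
Qed.

Lemma cofree_injective (M : module C) : injective_module (cofree_module M).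
Proof.
move=> N L i f iM.
have ext A (chi : {additive M A -> QZ}) : exists h : {additive L A -> QZ},
    forall x : N A, h (i A x) = cofree_val (f A x) chi (idm A).
  have eB : zmod_morphism (fun x : N A => cofree_val (f A x) chi (idm A)).
    by move=> x y; rewrite raddfB.
  exact: (QZ_extend (mk_additive eB) (@mono_inj _ _ _ iM A)).
pose h A chi := sval (cid (ext A chi)).
have hP A chi x : h A chi (i A x) = cofree_val (f A x) chi (idm A).
  exact: svalP (cid (ext A chi)) x.
have gB B (y : L B) A chi : zmod_morphism (fun a : hom B A => h A chi (mact L a y)).
  by move=> a b; rewrite (mactB y) raddfB.
pose g B (y : L B) : cofree M B := Cofree (gB B y).
have gBB B : zmod_morphism (g B).
  by move=> x y; apply: cofreeP => A chi a /=; rewrite !raddfB.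
have gN A B (a : hom A B) x : g B (mact L a x) = cofree_act M a (g A x).
  by apply: cofreeP => D chi b /=; rewrite mactM.
exists (@ModHom C L (cofree_module M) (fun B => mk_additive (gBB B)) gN).
apply: modhomP => B x; apply: cofreeP => A chi a /=.
by rewrite -mapp_nat hP mapp_nat /= comp1m.
Qed.

Lemma injres_exists (M : module C) : exists _ : injres M, True.
Proof.
pose K := fix K n : module C :=
  match n with 0 => M | m.+1 => coker (cofree_emb (K m)) end.
pose X n := cofree_module (K n).
pose p n : modhom (X n) (K n.+1) := coker_pi (cofree_emb (K n)).
pose d n : modhom (X n) (X n.+1) := mhcomp (cofree_emb (K n.+1)) (p n).
have d0 n A x : d n A x = 0 <-> exists y, cofree_emb (K n) A y = x.
  rewrite -coker_pi0; split=> [|px]; last first.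
    by rewrite [LHS](_ : _ = cofree_emb (K n.+1) A (p n A x)) // [p n A x]px raddf0.
  by rewrite -(raddf0 (cofree_emb (K n.+1) A)) => /cofree_emb_inj.
have dS n A x : d n.+1 A x = 0 <-> exists y, d n A y = x.
  rewrite d0; split=> [[y <-]|[y <-]]; last by exists (p n A y).
  by have [z ->] := quotmod_piP y; exists z.
exists (@InjRes C M (@Coresolution C M X (cofree_emb M) d
  (@cofree_emb_inj M) (d0 0%N) dS) (fun n => @cofree_injective (K n))) => //.
Qed.
End EnoughInjectives.

Definition injres_of (C : preadditive) (M : module C) : injres M :=
  sval (cid (injres_exists M)).

(* Additive functors Mod(C) -> Ab. *)
Record abfunctor (C : preadditive) := AbFunctor {
  af_obj :> module C -> zmodType;
  af_map : forall M N, modhom M N -> {additive af_obj M -> af_obj N};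
  af_mapD : forall M N (f g : modhom M N) x, af_map (f + g) x = af_map f x + af_map g x;
  af_map1 : forall M x, af_map (mhid M) x = x;
  af_mapM : forall M N L (g : modhom N L) (f : modhom M N) x,
    af_map (mhcomp g f) x = af_map g (af_map f x) }.

(* Additive functors Mod(C) -> Mod(D). *)
Record modfunctor (C D : preadditive) := ModFunctor {
  mf_obj :> module C -> module D;
  mf_map : forall M N, modhom M N -> modhom (mf_obj M) (mf_obj N);
  mf_mapD : forall M N (f g : modhom M N), mf_map (f + g) = mf_map f + mf_map g;
  mf_map1 : forall M, mf_map (mhid M) = mhid (mf_obj M);
  mf_mapM : forall M N L (g : modhom N L) (f : modhom M N),
    mf_map (mhcomp g f) = mhcomp (mf_map g) (mf_map f) }.

Section RightDerived.
Variable C : preadditive.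

Lemma af_map0 (T : abfunctor C) (M N : module C) x : af_map T (0 : modhom M N) x = 0.
Proof. by apply: (addrI (af_map T 0 x)); rewrite -af_mapD !addr0. Qed.

(* T applied to the complex 0 -> X^0 -> X^1 -> ..., without the augmentation. *)
Definition af_cochain (T : abfunctor C) (M : module C) (X : coresolution M) : cochain.
Proof.
refine (@Cochain (fun n => T (X n)) (fun n => af_map T (cr_diff X n)) _) => n x.
rewrite -af_mapM (_ : mhcomp _ _ = 0) ?af_map0 //.
by apply: modhomP => A y; exact: cr_diffK.
Defined.

(* (R^n T)(M) *)
Definition rderived (T : abfunctor C) (n : nat) (M : module C) : zmodType :=
  cohom (af_cochain T (injres_of M)) n.

Variable D : preadditive.

Definition mf_ev (T : modfunctor C D) (A : D) : abfunctor C.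
Proof.
by refine (@AbFunctor C (fun M => T M A) (fun M N f => mf_map T f A) _ _ _) => *;
  rewrite ?mf_mapD ?mf_map1 ?mf_mapM.
Defined.

Definition mf_ev_map (T : modfunctor C D) (A B : D) (f : hom A B)
  (M : module C) (X : coresolution M) :
  cochain_map (af_cochain (mf_ev T A) X) (af_cochain (mf_ev T B) X).
Proof.
by refine (@CochainMap (af_cochain (mf_ev T A) X) (af_cochain (mf_ev T B) X)
  (fun n => mact (T (X n)) f) _) => n x; rewrite /= mapp_nat.
Defined.

(* (R^n T)(M) for T : Mod(C) -> Mod(D); cohomology in Mod(D) is computed
   objectwise. *)
Definition rderived_mod (T : modfunctor C D) (n : nat) (M : module C) : module D.
Proof.
refine (@Module D (fun A => rderived (mf_ev T A) n M)
  (fun A B f => cohom_map (mf_ev_map T f (injres_of M)) n) _ _ _).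
- move=> A B f g h; have [z ->] := cohom_classP h; rewrite !cohom_mapE -raddfD.
  by congr (cohom_class _ _ _); apply: val_inj; rewrite /= mactD.
- move=> A h; have [z ->] := cohom_classP h; rewrite !cohom_mapE.
  by congr (cohom_class _ _ _); apply: val_inj; rewrite /= mact1.
- move=> A B E g f h; have [z ->] := cohom_classP h.
  rewrite (cohom_mapE (mf_ev_map T f _)) (cohom_mapE (mf_ev_map T g _)) cohom_mapE.
  by congr (cohom_class _ _ _); apply: val_inj; rewrite /= mactM.
Defined.
End RightDerived.

Definition hom_functor (C : preadditive) (F : module C) : abfunctor C.
Proof.
by refine (@AbFunctor C (fun M => modhom F M) (fun M N f => postcomp F f) _ _ _) => *;
  exact: modhomP.
Defined.

Definition Ext (C : preadditive) (n : nat) (F G : module C) : zmodType :=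
  rderived (hom_functor F) n G.

Section ExtPull.
Variables (C D : preadditive) (P : addfunctor C D) (F G : module D).

Let J := injres_of G.
Let PJ := pull_cores P J.
Let I := injres_of (pull P G).

Lemma pull_homB (M N : module D) : zmod_morphism (@pull_hom C D P M N).
Proof. by move=> f g; apply: modhomP. Qed.

(* Hom(F, J^n) -> Hom(F \o P, J^n \o P) -> Hom(F \o P, I^n), where J is an
   injective resolution of G and I one of G \o P. *)
Definition ext_pull_cochain :
  cochain_map (af_cochain (hom_functor F) J) (af_cochain (hom_functor (pull P F)) I).
Proof.
refine (@CochainMap (af_cochain (hom_functor F) J) (af_cochain (hom_functor (pull P F)) I)
  (fun n => postcomp (pull P F) (comparison PJ I n) \o
            mk_additive (@pull_homB F (J n))) _).
move=> n x; apply: modhomP => A y /=.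
exact: (congr1 (fun h : modhom (PJ n) (I n.+1) => h A (x (P A) y))
  (rmap_diff (comparison PJ I) n)).
Defined.

Definition ext_pull (n : nat) : {additive Ext n F G -> Ext n (pull P F) (pull P G)} :=
  cohom_map ext_pull_cochain n.
End ExtPull.

Section Idempotent.
Variables (C : preadditive) (I : ideal C).

Definition k_idempotent (k : nat) : Prop :=
  forall (F F' : module (quotcat I)) (i : nat), (i <= k)%N ->
    bijective (ext_pull (quotfun I) F F' i).

(* Hom_C(A, -) / I(A, -) as an object of Mod(C). *)
Definition qrep (A : C) : module C := pull (quotfun I) (rep (A : quotcat I)).

Definition qrep_map (A B : quotcat I) (f : hom A B) : modhom (qrep B) (qrep A) :=
  pull_hom (quotfun I) (rep_map f).

(* The functor M |-> Hom_Mod(C)(Hom_C(-, ?) / I(-, ?), M). *)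
Definition quot_hom_obj (M : module C) : module (quotcat I).
Proof.
refine (@Module (quotcat I) (fun A => modhom (qrep A) M)
  (fun A B f => precomp M (qrep_map f)) _ _ _).
- move=> A B f g x; apply: modhomP => X y /=.
  by rewrite -raddfD; congr (x X _); exact: compDr.
- by move=> A x; apply: modhomP => X y /=; congr (x X _); exact: compm1.
- by move=> A B E g f x; apply: modhomP => X y /=; congr (x X _); exact: compA.
Defined.

Definition quot_hom_map (M N : module C) (f : modhom M N) :
  modhom (quot_hom_obj M) (quot_hom_obj N).
Proof.
by refine (@ModHom _ (quot_hom_obj M) (quot_hom_obj N)
  (fun A => postcomp (qrep A) f) _) => A B g x; exact: (mhcompA f x (qrep_map g)).
Defined.

Definition quot_hom : modfunctor C (quotcat I).
Proof.
by refine (@ModFunctor C (quotcat I) quot_hom_obj quot_hom_map _ _ _) => *;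
  apply: modhomP => A x; exact: modhomP.
Defined.

Definition EXT (i : nat) (M : module C) : module (quotcat I) :=
  rderived_mod quot_hom i M.

Lemma EXT_Ext (i : nat) (M : module C) (A : C) :
  EXT i M (A : quotcat I) = Ext i (qrep A) M.
Proof.
have E (X : nat -> zmodType) (d : forall n, {additive X n -> X n.+1}) dK dK' :
    @Cochain X d dK = @Cochain X d dK' by congr Cochain; exact: Prop_irrelevance.
rewrite /EXT /Ext /rderived_mod /= /rderived; congr (cohom _ i).
exact: E.
Qed.
End Idempotent.

Definition is_zero_module (C : preadditive) (M : module C) : Prop :=
  forall (A : C) (x : M A), x = 0.

(* Main.v *)
From mathcomp Require Import all_boot all_order all_algebra.
From mathcomp Require Import boolp classical_sets.
Require Import Defs.

Set Implicit Arguments.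
Unset Strict Implicit.
Unset Printing Implicit Defensive.

Import GRing.Theory.
Local Open Scope ring_scope.

(** Write P for the projection C -> C/I, P* for the restriction along it, and H
for the functor M |-> Hom(C/I(A, -), M).  By Yoneda over the quotient category,
P* is left adjoint to H, and H (P* F') = F' because every C-linear map
C/I(A, -) -> P* F' is determined by the image of the class of the identity.
EXT^i is the i-th right derived functor of H, and computes the groups
Ext^i(P* (C/I)(A, -), -).

(b) implies (c): a representable module is projective, so
Ext^i((C/I)(A, -), F') = 0 for i >= 1, and the isomorphism transports this
vanishing to EXT^i(P* F')(A) ([EXT_eq0_of_bij]).

(c) implies (d) is a specialization.

(d) implies (c): embed F' in an injective J with cokernel Q.  The sequence
0 -> P* F' -> P* J -> P* Q -> 0 is exact and stays exact under H, so
EXT^1(P* F') = 0; in higher degrees EXT^(i+1)(P* F') lies between EXT^i(P* Q)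
and EXT^(i+1)(P* J), and induction on i applies ([EXT_eq0_dimshift]).

(c) implies (b): let X be an injective resolution of P* F'.  Since P* is exact,
H preserves injectives; by (c) the complex H X is exact in degrees 1, ..., k,
and its cohomology in degree 0 is H (P* F') = F'.  So H X agrees with an
injective resolution J of F' up to degree k, and
Hom(F, J) -> Hom(F, H X) = Hom(P* F, X) is an isomorphism on cohomology in
degrees at most k ([ext_pull_bij]); under the adjunction it is the comparison map.

The complex H X is only exact in degrees at most k.  All of the homological
algebra is therefore done for injective resolutions truncated at k
([kres]): such resolutions admit comparison maps, unique up to homotopy, and
hence compute the same cohomology up to degree k.  The long exact sequence
enters only in the form of [hom_exact_dimshift], which is proved with a horseshoe
resolution. *)

(** * Truncated injective resolutions *)

Lemma mh_congr (C : preadditive) (M N : module C) (f g : modhom M N) :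
  f = g -> forall A x, f A x = g A x.
Proof. by move=> ->. Qed.

Lemma mappB (C : preadditive) (M N : module C) (f g : modhom M N) A x :
  (f - g) A x = f A x - g A x.
Proof. by []. Qed.

Section Truncated.
Variable C : preadditive.

(** Comparison maps, homotopies and the twist of a horseshoe resolution are all
families of maps into injective modules in which each member prescribes the next
one on the image of a differential.  [Phi n c] is the prescription; the step
hypothesis is what propagates its compatibility with the kernel. *)
Lemma extend_family (X W : nat -> module C) (d : forall n, modhom (X n) (X n.+1))
    (Phi : forall n, modhom (X n) (W n) -> modhom (X n) (W n.+1))
    (c0 : modhom (X 0%N) (W 0%N)) (k : nat) :
  (forall n, injective_module (W n)) ->
  (forall A x, d 0%N A x = 0 -> Phi 0%N c0 A x = 0) ->
  (forall n (c : modhom (X n) (W n)) (c' : modhom (X n.+1) (W n.+1)), (n < k)%N ->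
    (forall A x, c' A (d n A x) = Phi n c A x) ->
    forall A x, d n.+1 A x = 0 -> Phi n.+1 c' A x = 0) ->
  exists c : forall n, modhom (X n) (W n), c 0%N = c0 /\
    forall n, (n <= k)%N -> forall A x, c n.+1 A (d n A x) = Phi n (c n) A x.
Proof.
move=> Winj start step.
pose ext n (c : modhom (X n) (W n)) : set (modhom (X n.+1) (W n.+1)) :=
  fun c' => forall A x, c' A (d n A x) = Phi n c A x.
(* The default value 0 is reached only beyond degree k + 1, where nothing is claimed. *)
pose s := fix s n : modhom (X n) (W n) :=
  match n with
  | 0 => c0
  | m.+1 => xget 0 (ext m (s m))
  end.
have sP n : (forall A x, d n A x = 0 -> Phi n (s n) A x = 0) ->
    forall A x, s n.+1 A (d n A x) = Phi n (s n) A x.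
  move=> kill; have [h hd] := injective_extend (Winj n.+1) kill.
  have : exists c', ext n (s n) c' by exists h => A x; rewrite -hd.
  by move/(xgetPex 0).
exists s; split=> // n; elim: n => [_|n IH nk]; first exact: sP.
by apply: sP; apply: (step n (s n)) => //; exact/IH/ltnW.
Qed.

(** Exactness is required in degrees 0, ..., k, while the objects are injective in
all degrees; in particular consecutive differentials need not compose to 0
beyond degree k. *)
Record kres (k : nat) (M : module C) := KRes {
  kr_obj :> nat -> module C;
  kr_aug : modhom M (kr_obj 0%N);
  kr_diff : forall n, modhom (kr_obj n) (kr_obj n.+1);
  kr_aug_inj : forall A, injective (kr_aug A);
  kr_exact0 : forall A x, kr_diff 0%N A x = 0 <-> exists y, kr_aug A y = x;
  kr_exactS : forall n, (n < k)%N -> forall A x,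
    kr_diff n.+1 A x = 0 <-> exists y, kr_diff n A y = x;
  kr_inj : forall n, injective_module (kr_obj n) }.

Definition injres_kres k (M : module C) (X : injres M) : kres k M :=
  @KRes k M X (cr_aug X) (cr_diff X) (@cr_aug_inj _ _ X) (@cr_exact0 _ _ X)
    (fun n _ => @cr_exactS _ _ X n) (@ir_inj _ _ X).

Section Comparison.
Variables (k : nat) (M : module C).
Implicit Types X Y Z : kres k M.

Lemma kr_diff_aug X A y : kr_diff X 0%N A (kr_aug X A y) = 0.
Proof. by apply/kr_exact0; exists y. Qed.

Lemma kr_diffK X n A x : (n < k)%N -> kr_diff X n.+1 A (kr_diff X n A x) = 0.
Proof. by move=> nk; apply/kr_exactS => //; exists x. Qed.

(** A chain map over the identity of M, in the degrees where both sides are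
resolutions. *)
Definition over_id X Y (f : forall n, modhom (X n) (Y n)) : Prop :=
  (forall A y, f 0%N A (kr_aug X A y) = kr_aug Y A y) /\
  forall n, (n <= k)%N -> forall A x,
    f n.+1 A (kr_diff X n A x) = kr_diff Y n A (f n A x).

Lemma over_id_exists X Y : exists f : forall n, modhom (X n) (Y n), over_id f.
Proof.
have [c0 c0E] : exists c, mhcomp c (kr_aug X) = kr_aug Y.
  apply: injective_extend; first exact: kr_inj.
  by move=> A x; rewrite -(raddf0 (kr_aug X A)) => /kr_aug_inj ->; rewrite raddf0.
have aug A y : c0 A (kr_aug X A y) = kr_aug Y A y by exact: (mh_congr c0E).
have [||f [f0 fd]] := @extend_family X Y (kr_diff X)
    (fun n c => mhcomp (kr_diff Y n) c) c0 k (@kr_inj _ _ Y).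
- by move=> A x /kr_exact0[y <-] /=; rewrite aug kr_diff_aug.
- move=> n c c' nk E A x /kr_exactS-/(_ nk)[y <-] /=.
  by rewrite E kr_diffK.
by exists f; split=> // A y; rewrite f0.
Qed.

(** The difference of the two maps kills the augmentation, so it factors through
the first differential; the higher terms of the homotopy are then found by
extension, using the exactness of [X].  The degree -1 term of the homotopy is 0,
which is why degree 0 has a separate equation. *)
Lemma over_id_homotopic X Y (f g : forall n, modhom (X n) (Y n)) :
  over_id f -> over_id g ->
  exists h : forall n, modhom (X n.+1) (Y n),
    (forall A x, f 0%N A x - g 0%N A x = h 0%N A (kr_diff X 0%N A x)) /\
    (forall n, (n < k)%N -> forall A x, f n.+1 A x - g n.+1 A x =
       h n.+1 A (kr_diff X n.+1 A x) + kr_diff Y n A (h n A x)).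
Proof.
move=> [fa fd] [ga gd].
have [h0 h0E] : exists h, mhcomp h (kr_diff X 0%N) = f 0%N - g 0%N.
  apply: injective_extend; first exact: kr_inj.
  by move=> A x /kr_exact0[y <-]; rewrite mappB fa ga subrr.
have h0P A x : h0 A (kr_diff X 0%N A x) = f 0%N A x - g 0%N A x.
  exact: (mh_congr h0E).
have [k0|k0] := leqP k 0.
  (* For k = 0 only the equation in degree 0 is required. *)
  pose h n : modhom (X n.+1) (Y n) :=
    match n return modhom (X n.+1) (Y n) with 0 => h0 | m.+1 => 0 end.
  exists h; split=> [A x|n]; first exact/esym/h0P.
  by move=> nk; move: (leq_ltn_trans (leq0n n) nk); rewrite ltnNge k0.
have [|||h [hh0 hd]] := @extend_family (fun n => X n.+1) Y (fun n => kr_diff X n.+1)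
    (fun n c => f n.+1 - g n.+1 - mhcomp (kr_diff Y n) c) h0 k.-1.
- exact: kr_inj.
- move=> A x /kr_exactS-/(_ k0)[y <-].
  by rewrite !mappB /= fd // gd // h0P -!raddfB subrr raddf0.
- move=> n c c' nk E A x.
  have nk1 : (n.+1 < k)%N by rewrite -(prednK k0).
  move=> /kr_exactS-/(_ nk1)[y <-].
  rewrite !mappB /= E !mappB /= (fd _ (ltnW nk1)) (gd _ (ltnW nk1)).
  rewrite 2!(raddfB (kr_diff Y n.+1 A)).
  by rewrite (kr_diffK _ (ltnW nk1)) subr0 subrr.
exists h; split=> [A x|n nk A x]; first by rewrite hh0 h0P.
rewrite hd ?mappB /= ?subrK //.
by rewrite -ltnS prednK.
Qed.

Lemma over_id_comp X Y Z (f : forall n, modhom (X n) (Y n))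
    (g : forall n, modhom (Y n) (Z n)) :
  over_id f -> over_id g -> @over_id X Z (fun n => mhcomp (g n) (f n)).
Proof.
move=> [fa fd] [ga gd]; split=> [A y|n nk A x] /=; first by rewrite fa ga.
by rewrite (fd _ nk) (gd _ nk).
Qed.

Lemma over_id_id X : @over_id X X (fun n => mhid (X n)).
Proof. by split. Qed.

(** Vanishing of the cohomology of Hom(G, X) in degree [n.+1]. *)
Definition hom_exact (G : module C) X n : Prop :=
  forall z : modhom G (X n.+1), (forall A x, kr_diff X n.+1 A (z A x) = 0) ->
    exists y : modhom G (X n), forall A x, kr_diff X n A (y A x) = z A x.

(** Any comparison map [f] has a homotopy inverse [g], because both composites are
homotopic to the identity.  Composing with maps out of G therefore makes [f] an
isomorphism on the cohomology of Hom(G, -) in degrees at most k; the lemmas below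
spell this out on cocycles, with degree 0 apart since it has no coboundaries. *)
Section HomIso.
Variables (G : module C) (X Y : kres k M) (f : forall n, modhom (X n) (Y n)).
Hypothesis fM : over_id f.

Lemma hom_cohom_inj0 (z : modhom G (X 0%N)) :
  (forall A x, kr_diff X 0%N A (z A x) = 0) ->
  (forall A x, f 0%N A (z A x) = 0) -> z = 0.
Proof.
move=> zK fz; have [g gM] := over_id_exists Y X.
have [h [h0 _]] := over_id_homotopic (over_id_comp fM gM) (over_id_id X).
apply: modhomP => A x; have := h0 A (z A x).
by rewrite zK raddf0 /= fz raddf0 sub0r => /eqP; rewrite oppr_eq0 => /eqP.
Qed.

Lemma hom_cohom_inj n (z : modhom G (X n.+1)) (w : modhom G (Y n)) : (n < k)%N ->
  (forall A x, kr_diff X n.+1 A (z A x) = 0) ->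
  (forall A x, kr_diff Y n A (w A x) = f n.+1 A (z A x)) ->
  exists y : modhom G (X n), forall A x, kr_diff X n A (y A x) = z A x.
Proof.
move=> nk zK wf; have [g gM] := over_id_exists Y X.
have [h [_ hS]] := over_id_homotopic (over_id_comp fM gM) (over_id_id X).
exists (mhcomp (g n) w - mhcomp (h n) z) => A x.
have := hS n nk A (z A x); rewrite zK raddf0 add0r mappB raddfB /= => <-.
by rewrite -(proj2 gM) ?(ltnW nk) // wf subKr.
Qed.

Lemma hom_cohom_surj0 (w : modhom G (Y 0%N)) :
  (forall A x, kr_diff Y 0%N A (w A x) = 0) ->
  exists z : modhom G (X 0%N), (forall A x, kr_diff X 0%N A (z A x) = 0) /\
    forall A x, f 0%N A (z A x) = w A x.
Proof.
move=> wK; have [g gM] := over_id_exists Y X.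
have [h [h0 _]] := over_id_homotopic (over_id_comp gM fM) (over_id_id Y).
exists (mhcomp (g 0%N) w); split=> A x /=; first by rewrite -(proj2 gM) // wK raddf0.
by apply/eqP; rewrite -subr_eq0; have := h0 A (w A x); rewrite wK raddf0 /= => ->.
Qed.

Lemma hom_cohom_surj n (w : modhom G (Y n.+1)) : (n < k)%N ->
  (forall A x, kr_diff Y n.+1 A (w A x) = 0) ->
  exists (z : modhom G (X n.+1)) (y : modhom G (Y n)),
    (forall A x, kr_diff X n.+1 A (z A x) = 0) /\
    forall A x, f n.+1 A (z A x) = w A x + kr_diff Y n A (y A x).
Proof.
move=> nk wK; have [g gM] := over_id_exists Y X.
have [h [_ hS]] := over_id_homotopic (over_id_comp gM fM) (over_id_id Y).
exists (mhcomp (g n.+1) w), (mhcomp (h n) w); split=> A x /=.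
  by rewrite -(proj2 gM) // wK raddf0.
have := hS n nk A (w A x); rewrite wK raddf0 add0r /= => <-.
by rewrite addrC subrK.
Qed.
End HomIso.

Lemma hom_exact_indep G X Y n : (n < k)%N -> hom_exact G X n -> hom_exact G Y n.
Proof.
move=> nk GX w wK; have [f fM] := over_id_exists X Y.
have [z [y [/GX[x zx] fz]]] := hom_cohom_surj fM nk wK.
exists (mhcomp (f n) x - y) => A a; rewrite mappB raddfB /=.
by rewrite -(proj2 fM) ?(ltnW nk) // zx fz addrK.
Qed.
End Comparison.

(** * Direct sums and the horseshoe resolution *)

Section DirectSum.
Variables M N : module C.

Lemma modsum_act_sub A B (f : hom A B) :
  zmod_morphism (fun u : M A * N A => (mact M f u.1, mact N f u.2)).
Proof. by move=> u v; rewrite /= !raddfB. Qed.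

Definition modsum : module C.
Proof.
by refine (@Module C (fun A => M A * N A)%type
  (fun A B f => mk_additive (@modsum_act_sub A B f)) _ _ _) => *;
  rewrite /= ?mactD ?mactM // !mact1 -surjective_pairing.
Defined.

Definition modsum_fst : modhom modsum M.
Proof. by refine (@ModHom C modsum M (fun A => fst) _). Defined.
Definition modsum_snd : modhom modsum N.
Proof. by refine (@ModHom C modsum N (fun A => snd) _). Defined.

Lemma modsum_pair_sub K (f : modhom K M) (g : modhom K N) A :
  zmod_morphism (fun x : K A => (f A x, g A x)).
Proof. by move=> x y; rewrite /= !raddfB. Qed.

Definition modsum_pair K (f : modhom K M) (g : modhom K N) : modhom K modsum.
Proof.
by refine (@ModHom C K modsum (fun A => mk_additive (@modsum_pair_sub K f g A)) _) => *;
  rewrite /= !mapp_nat.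
Defined.

Lemma modsum_injective : injective_module M -> injective_module N ->
  injective_module modsum.
Proof.
move=> Mi Ni K L i f iM.
have [g1 E1] := Mi _ _ i (mhcomp modsum_fst f) iM.
have [g2 E2] := Ni _ _ i (mhcomp modsum_snd f) iM.
exists (modsum_pair g1 g2); apply: modhomP => A x.
have := mh_congr E1 x; have := mh_congr E2 x => /= -> ->.
by rewrite -surjective_pairing.
Qed.
End DirectSum.

Lemma factor_mono (G M N : module C) (i : modhom M N) (f : modhom G N) :
  (forall A, injective (i A)) -> (forall A x, exists y, i A y = f A x) ->
  exists u : modhom G M, forall A x, i A (u A x) = f A x.
Proof.
move=> iI fi.
pose u A x := sval (cid (fi A x)).
have uP A x : i A (u A x) = f A x := svalP (cid (fi A x)).
have uB A : zmod_morphism (u A) by move=> x y; apply: (iI A); rewrite raddfB !uP raddfB.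
have uN A B (h : hom A B) x : u B (mact G h x) = mact M h (u A x).
  by apply: (iI B); rewrite uP !mapp_nat uP.
by exists (@ModHom C G M (fun A => mk_additive (uB A)) uN).
Qed.

(** Dimension shifting along a short exact sequence 0 -> M -> N -> Q -> 0. *)
Section Horseshoe.
Variables (k : nat) (M N Q : module C) (i : modhom M N) (p : modhom N Q).
Hypothesis i_inj : forall A, injective (i A).
Hypothesis ip_exact : forall A x, p A x = 0 <-> exists y, i A y = x.
Hypothesis p_surj : forall A q, exists x, p A x = q.
Variables (X : kres k M) (Z : kres k Q).

(** On the sums X^n + Z^n the differential (x, z) |-> (dx + tau z, dz) squares to 0
when tau anticommutes with the differentials.  The map tau lifts the connecting
map Q -> coker (M -> X^0), up to sign; this is what [tau0] expresses. *)
Section Twisted.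
Variables (nu : modhom N (X 0%N)) (tau : forall n, modhom (Z n) (X n.+1)).
Hypothesis nuE : forall A y, nu A (i A y) = kr_aug X A y.
Hypothesis tau0 : forall A x,
  tau 0%N A (kr_aug Z A (p A x)) = - kr_diff X 0%N A (nu A x).
Hypothesis tauS : forall n, (n < k)%N -> forall A z,
  tau n.+1 A (kr_diff Z n A z) = - kr_diff X n.+1 A (tau n A z).

Let Y n := modsum (X n) (Z n).
Let augY : modhom N (Y 0%N) := modsum_pair nu (mhcomp (kr_aug Z) p).
Let dY n : modhom (Y n) (Y n.+1) :=
  modsum_pair (mhcomp (kr_diff X n) (modsum_fst _ _) + mhcomp (tau n) (modsum_snd _ _))
    (mhcomp (kr_diff Z n) (modsum_snd _ _)).

Let dYE n A x z :
  dY n A (x, z) = (kr_diff X n A x + tau n A z, kr_diff Z n A z).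
Proof. by []. Qed.

Let augY_inj A : injective (augY A).
Proof.
apply: raddf_inj => x [nux].
rewrite -(raddf0 (kr_aug Z A)) => /kr_aug_inj /ip_exact[y yx].
by move: nux; rewrite -yx nuE -(raddf0 (kr_aug X A)) => /kr_aug_inj ->; rewrite raddf0.
Qed.

Let exactY0 A x : dY 0%N A x = 0 <-> exists y, augY A y = x.
Proof.
split=> [|[y <-]]; last first.
  by rewrite [LHS]dYE /= tau0 subrr kr_diff_aug.
case: x => x z; rewrite dYE => -[+ /kr_exact0[q qz]].
have [y yq] := p_surj q; rewrite -qz -yq tau0 -raddfB => /kr_exact0[m mx].
exists (y + i A m); rewrite /= !raddfD nuE mx addrC subrK.
by have /ip_exact-> : exists m', i A m' = i A m by [exists m]; rewrite raddf0 addr0.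
Qed.

Let exactYS n : (n < k)%N -> forall A x, dY n.+1 A x = 0 <-> exists y, dY n A y = x.
Proof.
move=> nk A x; split=> [|[[y1 y2] <-]]; last first.
  rewrite !dYE kr_diffK // tauS // raddfD kr_diffK // add0r subrr.
  by [].
case: x => x z; rewrite dYE => -[+ /(kr_exactS nk)[z' zE]].
rewrite -zE tauS // -raddfB => /(kr_exactS nk)[x' x'E].
by exists (x', z'); rewrite dYE x'E subrK.
Qed.

Definition twisted_sum : kres k N :=
  @KRes k N Y augY dY augY_inj exactY0 exactYS
    (fun n => modsum_injective (@kr_inj k M X n) (@kr_inj k Q Z n)).
End Twisted.

(** This is the part Ext^n(G, Q) -> Ext^(n+1)(G, M) -> Ext^(n+1)(G, N) of the long
exact sequence.  A cocycle z of X becomes in the horseshoe resolution the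
coboundary of some (a, b), where b is a cocycle of Z.  If b is a coboundary, or in
degree 0 if the map G -> Q that it represents lifts to N, then b can be removed
by changing (a, b), and z is a coboundary in X. *)
Lemma hom_exact_dimshift (G : module C) (W : kres k N) n : (n < k)%N ->
  hom_exact G W n ->
  match n with
  | 0 => forall u : modhom G Q, exists v : modhom G N, forall A x, p A (v A x) = u A x
  | m.+1 => hom_exact G Z m
  end -> hom_exact G X n.
Proof.
move=> nk GW GZ.
have [nu nuE] : exists nu, mhcomp nu i = kr_aug X.
  apply: injective_extend; first exact: kr_inj.
  by move=> A x; rewrite -(raddf0 (i A)) => /i_inj ->; rewrite raddf0.
have {}nuE A y : nu A (i A y) = kr_aug X A y by exact: (mh_congr nuE).
have [t0 t0E] : exists t0, mhcomp t0 (mhcomp (kr_aug Z) p) = - mhcomp (kr_diff X 0%N) nu.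
  apply: injective_extend; first exact: kr_inj.
  move=> A x /=; rewrite -(raddf0 (kr_aug Z A)) => /kr_aug_inj /ip_exact[y <-].
  by rewrite nuE kr_diff_aug oppr0.
have {}t0E A x : t0 A (kr_aug Z A (p A x)) = - kr_diff X 0%N A (nu A x).
  exact: (mh_congr t0E).
have [|||tau [tau0 tauS]] := @extend_family Z (fun n => X n.+1) (kr_diff Z)
    (fun n c => - mhcomp (kr_diff X n.+1) c) t0 k.-1.
- by move=> m; exact: kr_inj.
- move=> A z /kr_exact0[q <-]; have [x <-] := p_surj q.
  by rewrite /= t0E raddfN opprK kr_diffK // (leq_ltn_trans (leq0n n) nk).
- move=> m c c' mk cE A x.
  have mk1 : (m.+1 < k)%N by rewrite -(prednK (leq_ltn_trans (leq0n n) nk)).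
  move=> /(kr_exactS (ltnW mk1))[z <-].
  by rewrite /= cE /= raddfN opprK kr_diffK.
have tau0E A x : tau 0%N A (kr_aug Z A (p A x)) = - kr_diff X 0%N A (nu A x).
  by rewrite tau0.
have tauE m : (m < k)%N -> forall A z,
    tau m.+1 A (kr_diff Z m A z) = - kr_diff X m.+1 A (tau m A z).
  move=> mk; apply: tauS.
  by rewrite -ltnS prednK // (leq_ltn_trans (leq0n n) nk).
have GY := hom_exact_indep (Y := twisted_sum nuE tau0E tauE) nk GW.
move=> z zK.
have [|w wE] := GY (modsum_pair z 0).
  by move=> A x; rewrite /= zK !raddf0 addr0.
have w1 A x : kr_diff X n A (w A x).1 + tau n A (w A x).2 = z A x.
  by have := congr1 fst (wE A x).
have w2 A x : kr_diff Z n A (w A x).2 = 0.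
  by have := congr1 snd (wE A x).
case: n nk GZ {GW GY} z zK w wE w1 w2 => [|m] nk GZ z zK w wE w1 w2.
  have [u uE] := factor_mono (f := mhcomp (modsum_snd _ _) w) (@kr_aug_inj _ _ Z)
    (fun A x => proj1 (@kr_exact0 _ _ Z A _) (w2 A x)).
  have [v vE] := GZ u.
  exists (mhcomp (modsum_fst _ _) w - mhcomp nu v) => A x.
  by rewrite mappB raddfB /= -tau0E vE uE /= w1.
have [b bE] := GZ (mhcomp (modsum_snd _ _) w) w2.
exists (mhcomp (modsum_fst _ _) w - mhcomp (tau m) b) => A x.
by rewrite mappB raddfB /= -tauE ?(ltnW nk) // bE /= w1.
Qed.
End Horseshoe.
End Truncated.

(** * Cohomology classes and cocycles *)

Lemma cohomS_eq0 (X : cochain) n :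
  (forall h : cohom X n.+1, h = 0) <->
  (forall x : X n.+1, cdiff X n.+1 x = 0 -> exists y, cdiff X n y = x).
Proof.
split=> [H x xK|H h].
  have xP : x \in cocycle_pred X n.+1 by apply/eqP.
  exact: (proj1 (cohom_class0 (Cocycle xP)) (H _)).
by have [z ->] := cohom_classP h; apply/cohom_class0/H/cocycleP.
Qed.

Lemma cohom_map_bij (X Y : cochain) (f : cochain_map X Y) n :
  (forall z : X n, cdiff X n z = 0 -> is_coboundary (f n z) -> is_coboundary z) ->
  (forall w : Y n, cdiff Y n w = 0 ->
    exists2 z : X n, cdiff X n z = 0 & is_coboundary (f n z - w)) ->
  bijective (cohom_map f n).
Proof.
move=> inj surj.
have fI : injective (cohom_map f n).
  apply: raddf_inj => h; have [z ->] := cohom_classP h.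
  by rewrite cohom_mapE => /cohom_class0 /(inj _ (cocycleP z)) /cohom_class0.
have fS h : exists g, cohom_map f n g = h.
  have [w ->] := cohom_classP h; have [z zK zw] := surj _ (cocycleP w).
  have zP : z \in cocycle_pred X n by apply/eqP.
  exists (cohom_class X n (Cocycle zP)); apply/eqP.
  by rewrite -subr_eq0 cohom_mapE -raddfB; apply/eqP/cohom_class0.
have gK h : cohom_map f n (sval (cid (fS h))) = h := svalP (cid (fS h)).
by exists (fun h => sval (cid (fS h))) => // x; apply: fI; rewrite gK.
Qed.

Lemma hom_exact_Ext (C : preadditive) k (G M : module C) n :
  hom_exact G (injres_kres k (injres_of M)) n <-> forall h : Ext n.+1 G M, h = 0.
Proof.
rewrite cohomS_eq0; split=> H z zK.
  have [A x|y yz] := H z; first exact: (mh_congr zK).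
  by exists y; apply: modhomP.
have [|y yz] := H z; first exact: modhomP.
by exists y => A x; rewrite -yz.
Qed.

(** * Representable modules *)

Section Yoneda.
Variable C : preadditive.

Definition yoneda (F : module C) (A : C) (x : F A) : modhom (rep A) F.
Proof.
by refine (@ModHom C (rep A) F (fun B => mk_additive (@mactB C F A B x)) _) => *;
  rewrite /= mactM.
Defined.

Arguments yoneda {F A} x.

Lemma yonedaK (F : module C) (A : C) (g : modhom (rep A) F) : yoneda (g A (idm A)) = g.
Proof.
by apply: modhomP => B f; have := mapp_nat g f (idm A); rewrite /= compm1 => ->.
Qed.

(** Representable modules are projective: a cocycle on Hom(A, -) is an element of
the complex at A, where the complex is exact. *)
Lemma hom_exact_rep k (F : module C) (X : kres k F) (A : C) n :
  (n < k)%N -> hom_exact (rep A) X n.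
Proof.
move=> nk z zK; have [y yE] := proj1 (kr_exactS nk _) (zK A (idm A)).
exists (yoneda y) => B f; rewrite /= mapp_nat yE.
exact: (mh_congr (yonedaK z)).
Qed.
End Yoneda.
Arguments yoneda {C F A} x.

(** * Restriction along the quotient functor and its right adjoint *)

Section Idempotence.
Variables (C : preadditive) (I : ideal C).
Local Notation P := (quotfun I).
Local Notation D := (quotcat I).

Lemma EXT_eq0 k i (M : module C) :
  is_zero_module (EXT I i.+1 M) <->
  forall A : C, hom_exact (qrep I A) (injres_kres k (injres_of M)) i.
Proof.
split=> H A; first by apply/hom_exact_Ext; rewrite -EXT_Ext; exact: H.
by have := proj1 (hom_exact_Ext _ _ _ _) (H A); rewrite -EXT_Ext.
Qed.

(** C-linear maps out of Hom(A, -)/I(A, -) into a restricted module obey Yoneda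
over the quotient category, because every morphism there lifts to C.  So the
unit F' -> H (P* F') of the adjunction is an isomorphism. *)
Lemma qrep_yonedaK (F : module D) (A : C) (g : modhom (qrep I A) (pull P F)) :
  pull_hom P (@yoneda D F A (g A (idm (A : D)))) = g.
Proof.
apply: modhomP => B h.
have [f ->] : exists f, h = qpi I A B f by exists (repr h); rewrite qpiK.
have := mapp_nat g f (idm (A : D)) => /= <-; congr (g B _).
exact: (@compm1 D A B).
Qed.

Section Adjunction.
Variables (F : module D) (M : module C).

Lemma adj_sub (f : modhom (pull P F) M) (A : D) :
  zmod_morphism (fun x : F A => mhcomp f (pull_hom P (@yoneda D F A x))).
Proof. by move=> x y; apply: modhomP => B h /=; rewrite -!raddfB. Qed.

Definition adj (f : modhom (pull P F) M) : modhom F (quot_hom_obj I M).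
Proof.
refine (@ModHom D F (quot_hom_obj I M) (fun A => mk_additive (@adj_sub f A)) _).
by move=> A B g x; apply: modhomP => E h /=; rewrite -mactM.
Defined.

Lemma unadj_sub (g : modhom F (quot_hom_obj I M)) (A : C) :
  zmod_morphism (fun x : pull P F A => (g A x : modhom (qrep I A) M) A (idm (A : D))).
Proof. by move=> x y; rewrite raddfB. Qed.

Lemma unadj_nat (g : modhom F (quot_hom_obj I M)) (A B : C) (f : hom A B) x :
  (g B (mact F (fmap P f) x) : modhom (qrep I B) M) B (idm (B : D)) =
  mact M f ((g A x : modhom (qrep I A) M) A (idm (A : D))).
Proof.
rewrite mapp_nat -(mapp_nat (g A x : modhom (qrep I A) M)) /=.
congr ((g A x : modhom _ _) B _).
exact: etrans (@comp1m D _ _ _) (esym (@compm1 D _ _ _)).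
Qed.

Definition unadj (g : modhom F (quot_hom_obj I M)) : modhom (pull P F) M :=
  @ModHom C (pull P F) M (fun A => mk_additive (@unadj_sub g A)) (unadj_nat g).

Lemma adj_eval (f : modhom (pull P F) M) (A : C) x :
  (adj f A x : modhom (qrep I A) M) A (idm (A : D)) = f A x.
Proof. by rewrite /= (@mact1 D). Qed.

Lemma unadjK g : adj (unadj g) = g.
Proof.
apply: modhomP => A x; apply: modhomP => B h /=.
rewrite mapp_nat /=; congr ((g A x : modhom _ _) B _); exact: (@comp1m D).
Qed.
End Adjunction.

Lemma adj_precomp (F G : module D) (M : module C) (f : modhom (pull P G) M)
    (z : modhom F G) A x :
  adj (mhcomp f (pull_hom P z)) A x = adj f A (z A x).
Proof. by apply: modhomP => B h /=; rewrite mapp_nat. Qed.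

Lemma adj_postcomp (F : module D) (M N : module C) (g : modhom M N)
    (f : modhom (pull P F) M) A x :
  adj (mhcomp g f) A x = quot_hom_map I g A (adj f A x).
Proof. exact: modhomP. Qed.

(** H is right adjoint to restriction, which preserves monomorphisms. *)
Lemma quot_hom_injective (M : module C) :
  injective_module M -> injective_module (quot_hom_obj I M).
Proof.
move=> Mi F G i f iM.
have [|g gE] := Mi _ _ (pull_hom P i) (unadj f).
  by apply: mono_of_inj => A; exact: (mono_inj iM (A := A : D)).
exists (adj g); rewrite -[RHS]unadjK -gE.
by apply: modhomP => A x; apply: modhomP => B h /=; rewrite mapp_nat.
Qed.

(** If EXT^i(P* F') vanishes for 1 <= i <= k, then H turns an injective resolution
of P* F' into a resolution of F' up to degree k: exactness in positive degrees is
the vanishing, and in degree 0 it is H (P* F') = F' together with the left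
exactness of H. *)
Section QuotHomResolution.
Variables (k : nat) (F' : module D).
Let X := injres_of (pull P F').
Hypothesis EXT0 : forall i, (1 <= i <= k)%N -> is_zero_module (EXT I i (pull P F')).

Let Hd n := quot_hom_map I (cr_diff X n).

Let Haug_inj A : injective (adj (cr_aug X) A).
Proof.
move=> x y /mh_congr/(_ A (idm (A : D))) /= /cr_aug_inj.
by rewrite !(@mact1 D).
Qed.

Let Hexact0 A x : Hd 0%N A x = 0 <-> exists y, adj (cr_aug X) A y = x.
Proof.
split=> [/mh_congr xK|[y <-]]; last first.
  by apply: modhomP => B h; exact: cr_diff_aug.
have [|u uE] := factor_mono (f := x) (@cr_aug_inj _ _ X).
  by move=> B h; apply/cr_exact0/xK.
exists (u A (idm (A : D))); apply: modhomP => B h.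
by rewrite -uE -[in RHS](qrep_yonedaK u).
Qed.

Let HexactS n : (n < k)%N -> forall A x, Hd n.+1 A x = 0 <-> exists y, Hd n A y = x.
Proof.
move=> nk A x; split=> [/mh_congr xK|[y <-]]; last first.
  by apply: modhomP => B h; exact: cr_diffK.
have [y yE] := proj1 (EXT_eq0 k n _) (EXT0 (i := n.+1) nk) A x xK.
by exists y; exact: modhomP.
Qed.

Definition quot_hom_kres : kres k F' :=
  KRes Haug_inj Hexact0 HexactS (fun n => quot_hom_injective (@ir_inj _ _ X n)).
End QuotHomResolution.

(** * The equivalence *)

Section ExtPullIso.
Variables (k : nat) (F F' : module D).
Hypothesis EXT0 : forall i, (1 <= i <= k)%N -> is_zero_module (EXT I i (pull P F')).

Let J := injres_of F'.
Let X := injres_of (pull P F').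
Let c n : modhom (pull P (J n)) (X n) := comparison (pull_cores P J) X n.

Lemma adj_comparison :
  over_id (X := injres_kres k J) (Y := quot_hom_kres EXT0) (fun n => adj (c n)).
Proof.
split=> [A y|n nk A x].
  rewrite -[LHS]adj_precomp; congr (adj _ A y).
  exact: (rmap_aug (comparison (pull_cores P J) X)).
rewrite -[LHS]adj_precomp -[RHS]adj_postcomp; congr (adj _ A x).
exact: (rmap_diff (comparison (pull_cores P J) X)).
Qed.

(** Under the adjunction Hom(P* F, X) = Hom(F, H X), the map defining [ext_pull]
is composition with the comparison map J -> H X of [adj_comparison], which is an
isomorphism on cohomology up to degree k. *)
Lemma ext_pull_bij i : (i <= k)%N -> bijective (ext_pull P F F' i).
Proof.
move=> ik; apply: cohom_map_bij => [z /mh_congr zK|w /mh_congr wK].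
- case: i ik z zK => [|n] nk z zK /=.
    move=> cz0; apply: (hom_cohom_inj0 adj_comparison zK) => A x.
    rewrite -adj_precomp [X in adj X](_ : _ = 0); first exact: modhomP.
    exact: cz0.
  move=> [w wE].
  have [|y yE] := hom_cohom_inj adj_comparison (w := adj w) nk zK.
    by move=> A x; rewrite -[LHS]adj_postcomp -adj_precomp; congr (adj _ A x).
  by exists y; exact: modhomP.
- have awK A x : quot_hom_map I (cr_diff X i) A (adj w A x) = 0.
    by apply: modhomP => B y; exact: wK.
  case: i ik w awK {wK} => [|n] nk w awK.
    have [z [zK zE]] := hom_cohom_surj0 adj_comparison awK.
    exists z; first exact: modhomP.
    apply: modhomP => A x; apply/eqP; rewrite subr_eq0; apply/eqP.
    by rewrite -[RHS]adj_eval -zE adj_eval.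
  have [z [y [zK zE]]] := hom_cohom_surj adj_comparison nk awK.
  exists z; first exact: modhomP.
  have zE' A x : c n.+1 A (z A x) = w A x + cr_diff X n A (unadj y A x).
    by rewrite -(adj_eval (c n.+1)) zE mappD adj_eval.
  exists (unadj y); apply: modhomP => A x.
  by apply/esym/(canLR (addrK _)); rewrite addrC; exact: zE'.
Qed.
End ExtPullIso.
End Idempotence.

Lemma EXT_eq0_of_bij (C : preadditive) (I : ideal C) (F' : module (quotcat I)) i :
  (forall F, bijective (ext_pull (quotfun I) F F' i.+1)) ->
  is_zero_module (EXT I i.+1 (pull (quotfun I) F')).
Proof.
move=> bij A; rewrite EXT_Ext => h.
have Ext0 : forall g : Ext i.+1 (rep (A : quotcat I)) F', g = 0.
  by apply/(hom_exact_Ext i.+1)/hom_exact_rep.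
have [g _ gK] := bij (rep (A : quotcat I)).
by have := gK h; rewrite (Ext0 (g h)) raddf0 => <-.
Qed.

(** The higher vanishing for Q is the input in positive degrees.  In degree 0 the
input is that H (P* N) -> H (P* Q) is onto, which by Yoneda is the
surjectivity of N -> Q. *)
Lemma EXT_eq0_dimshift (C : preadditive) (I : ideal C) (M N Q : module (quotcat I))
    (a : modhom M N) (p : modhom N Q) i :
  (forall A, injective (a A)) ->
  (forall A x, p A x = 0 <-> exists y, a A y = x) ->
  (forall A q, exists x, p A x = q) ->
  is_zero_module (EXT I i.+1 (pull (quotfun I) N)) ->
  ((0 < i)%N -> is_zero_module (EXT I i (pull (quotfun I) Q))) ->
  is_zero_module (EXT I i.+1 (pull (quotfun I) M)).
Proof.
move=> aI ap pS /(EXT_eq0 I i.+1) NE QE; apply/(EXT_eq0 I i.+1) => A.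
apply: (@hom_exact_dimshift C i.+1 _ _ _ (pull_hom (quotfun I) a) (pull_hom (quotfun I) p)
  aI ap pS _ (injres_kres i.+1 (injres_of (pull (quotfun I) Q))) _ _ i (ltnSn i) (NE A)).
case: i QE {NE} => [_ u|i QE]; last exact: (proj1 (EXT_eq0 I i.+2 _ _) (QE isT)).
have [x xE] := pS A (u A (idm (A : quotcat I))).
exists (pull_hom (quotfun I) (@yoneda (quotcat I) N A x)) => B h.
by rewrite -[in RHS](qrep_yonedaK u) -xE /= mapp_nat.
Qed.

Lemma EXT_eq0_of_injective (C : preadditive) (I : ideal C) k :
  (forall i (J : module (quotcat I)), (1 <= i <= k)%N -> injective_module J ->
    is_zero_module (EXT I i (pull (quotfun I) J))) ->
  forall i (F' : module (quotcat I)), (1 <= i <= k)%N ->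
    is_zero_module (EXT I i (pull (quotfun I) F')).
Proof.
move=> EXTJ; elim=> [//|i IH] F' ik; have [J _] := injres_exists F'.
apply: (EXT_eq0_dimshift (p := coker_pi (cr_aug J))).
- exact: cr_aug_inj.
- exact: coker_pi0.
- by move=> A q; have [x ->] := quotmod_piP q; exists x.
- by apply: EXTJ => //; exact: (@ir_inj _ _ J 0%N).
- by move=> i0; apply: IH; rewrite i0 ltnW.
Qed.

Theorem proposition5p2 (C : preadditive) (I : ideal C) (k : nat)
    (hk : (1 <= k)%N) :
  [<-> k_idempotent I k;
       forall (F F' : module (quotcat I)) (i : nat), (i <= k)%N ->
         bijective (ext_pull (quotfun I) F F' i);
       forall (i : nat) (F' : module (quotcat I)), (1 <= i <= k)%N ->
         is_zero_module (EXT I i (pull (quotfun I) F'));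
       forall (i : nat) (J : module (quotcat I)), (1 <= i <= k)%N ->
         injective_module J -> is_zero_module (EXT I i (pull (quotfun I) J))].
Proof.
tfae.
- by [].
- move=> bij [//|i] F' /andP[_ ik].
  by apply: EXT_eq0_of_bij => F; exact: bij.
- by move=> EXT0 i J ik _; exact: EXT0.
- move=> EXTJ F F' i ik; apply: (ext_pull_bij (k := k)) => // j jk.
  exact: (EXT_eq0_of_injective EXTJ).
Qed.
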